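(* Let $(M,g)$ be a compact Riemannian manifold without boundary, let $H\subset M$ be a smooth hypersurface, and let $\mu$ be a probability measure on $S^*M$ that is invariant under the flow $\phi_t=\exp(tH_p)$, $p=|\xi|_g^2$. Then: (1) $\mu|_{S^*_HM}=\mu|_{S^*H}$. (2) The support of $\mu|_{S^*H}$ is contained in the null-space of the second fundamental form $Q(0,x',\xi')$ of $H$, i.e. $Q(0,x',\xi')=0$ for all $(x',\xi')\in\operatorname{supp}(\mu|_{S^*H})$. (3) Hence $\mu|_{S^*H}$ is supported on the subset of $S^*H$ where the Hamilton vector field $H_p$ coincides with the Hamilton vector field of the submanifold metric norm $|\xi'|^2_{g_H}$ of $H$ (the vector field on $T^*H$ denoted $H_{p|_{S^*H}}$).
   Context: $S^*_HM=\{(x,\xi)\in S^*M:x\in H\}$ and $S^*H\subset S^*_HM$ is the set of unit covectors (co)tangent to $H$. For a Borel set $E$, $\mu|_E=\mathbf 1_E\mu$. $H_p$ is the Hamilton vector field of $p$. In Fermi normal coordinates $(x',x_n)$ near $H=\{x_n=0\}$ ($x_n$ the signed normal distance) with dual coordinates $(\xi',\xi_n)$, $p=\xi_n^2+R_2(x',x_n,\xi')$, where $R_2(x',x_n,\xi')=|\xi'|^2_{g_H(x',x_n)}$ is a quadratic form in $\xi'$, and $R_2(x',x_n,\xi')=R_2(x',0,\xi')+2x_nQ$ with $Q$ smooth; the value of $Q$ at $x_n=0$, denoted $Q(0,x',\xi')=\tfrac12\partial_{x_n}R_2(x',0,\xi')$, is the second fundamental form of $H$ (as a quadratic form in $\xi'$).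 $S^*H$ is $\{x_n=0,\xi_n=0,|\xi'|_{g_H}=1\}$, $T^*H$ is identified with $\{x_n=0,\xi_n=0\}$, and $R_2(x',0,\xi')=|\xi'|^2_{g_H}$. *)

(* Defs.v *)
From HB Require Import structures.
From mathcomp Require Import all_boot all_order all_algebra.
From mathcomp Require Import all_classical all_reals all_analysis.

Set Implicit Arguments.
Unset Strict Implicit.
Unset Printing Implicit Defensive.

Import Order.TTheory GRing.Theory Num.Theory.
Import numFieldNormedType.Exports.

Local Open Scope classical_set_scope.
Local Open Scope ring_scope.

(* Tangent and cotangent vectors are row vectors, and [jacobian] acts on the
   right: for x' = tau x and J = jacobian tau x, tangent vectors transform as
   v' = v *m J, covectors as xi = xi' *m J^T, metrics as G = J *m G' *m J^T. *)

Section Smooth.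
Variables (R : realType) (d : nat).
Implicit Types (U : set 'rV[R]_d) (f : 'rV[R]_d -> R).

(* Having all iterated partial derivatives differentiable is equivalent to
   being C^oo on the open set U. *)
Fixpoint differentiable_upto (k : nat) U f : Prop :=
  match k with
  | 0 => forall x, U x -> {for x, continuous f}
  | k'.+1 => (forall x, U x -> differentiable f x) /\
             forall i : 'I_d,
               differentiable_upto k' U (fun x => 'D_(delta_mx 0 i) f x)
  end.

Definition smooth_on U f := forall k, differentiable_upto k U f.

Definition smooth_map_on (e : nat) U (F : 'rV[R]_d -> 'rV[R]_e) :=
  forall j : 'I_e, smooth_on U (fun x => F x 0 j).

(* Canonical coordinates (x, xi):
   H_P = sum_i (d P / d xi_i) d/dx_i - (d P / d x_i) d/dxi_i. *)
Definition hamilton_field (P : 'rV[R]_d -> 'rV[R]_d -> R) (x xi : 'rV[R]_d) :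
    'rV[R]_d * 'rV[R]_d :=
  (\row_i 'D_(delta_mx 0 i) (P x) xi,
   - \row_i 'D_(delta_mx 0 i) (P^~ xi) x).

End Smooth.

(* Charts are total functions; the values of [cmap] outside [cdom] and of
   [cinv] outside [ccod] are irrelevant. *)
Record chart (R : realType) (d : nat) (T : Type) := Chart {
  cdom : set T;
  cmap : T -> 'rV[R]_d;
  cinv : 'rV[R]_d -> T }.

Section Charts.
Variables (R : realType) (d : nat) (T : topologicalType).
Implicit Types c : chart R d T.

Definition ccod c : set 'rV[R]_d := cmap c @` cdom c.

Definition is_chart c :=
  [/\ open (cdom c), open (ccod c),
      (forall x, cdom c x -> cinv c (cmap c x) = x),
      (forall x, cdom c x -> {for x, continuous (cmap c)}) &
      (forall y, ccod c y -> {for y, continuous (cinv c)})].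

Definition transition c c' : 'rV[R]_d -> 'rV[R]_d := cmap c' \o cinv c.

Definition smooth_transition c c' :=
  smooth_map_on (cmap c @` (cdom c `&` cdom c')) (transition c c').

End Charts.

(* The smooth structure is a maximal atlas. *)
Record smoothManifold (R : realType) (d : nat) := SmoothManifold {
  carrier :> ptopologicalType;
  atlas : set (chart R d carrier);
  manifold_hausdorff : hausdorff_space carrier;
  manifold_second_countable : @second_countable carrier;
  atlas_chart : forall c, atlas c -> is_chart c;
  atlas_cover : forall x : carrier, exists2 c, atlas c & cdom c x;
  atlas_smooth : forall c c', atlas c -> atlas c' -> smooth_transition c c';
  atlas_maximal : forall c, is_chart c ->
    (forall c', atlas c' -> smooth_transition c c' /\ smooth_transition c' c) ->
    atlas c }.

(* gmx c x is the matrix of the metric in the chart c, at the point of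
   coordinates x. *)
Record riemannianMetric (R : realType) (d : nat) (M : smoothManifold R d) :=
    RiemannianMetric {
  gmx : chart R d M -> 'rV[R]_d -> 'M[R]_d;
  gmx_smooth : forall c, atlas c -> forall i j,
    smooth_on (ccod c) (fun x => gmx c x i j);
  gmx_sym : forall c, atlas c -> forall x, ccod c x ->
    (gmx c x)^T = gmx c x;
  gmx_pos : forall c, atlas c -> forall x, ccod c x ->
    forall v : 'rV[R]_d, v != 0 -> 0 < (v *m gmx c x *m v^T) 0 0;
  gmx_change : forall c c', atlas c -> atlas c' ->
    forall x, cdom c x -> cdom c' x ->
    let J := jacobian (transition c c') (cmap c x) in
    gmx c (cmap c x) = J *m gmx c' (cmap c' x) *m J^T }.

(* A point (x, xi) of T^*M: xi is the family of its coordinates in all the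
   charts around x, extended by 0 to the other charts so that equality of
   covectors is Leibniz equality. *)
Record covector (R : realType) (d : nat) (M : smoothManifold R d) := Covector {
  base : M;
  coord : chart R d M -> 'rV[R]_d;
  coord_change : forall c c', atlas c -> atlas c' ->
    cdom c base -> cdom c' base ->
    coord c = coord c' *m (jacobian (transition c c') (cmap c base))^T;
  coord_out : forall c, ~ (atlas c /\ cdom c base) -> coord c = 0 }.

Section Cotangent.
Variables (R : realType) (d : nat) (M : smoothManifold R d).

HB.instance Definition _ := gen_eqMixin (covector M).
HB.instance Definition _ := gen_choiceMixin (covector M).

Program Definition covector0 : covector M := @Covector R d M point (fun=> 0) _ _.
Next Obligation. by move=> *; rewrite mul0mx. Qed.
Next Obligation. by []. Qed.

HB.instance Definition _ := isPointed.Build (covector M) covector0.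

Definition bcoord (z : covector M) (c : chart R d M) : 'rV[R]_d :=
  cmap c (base z).

(* The topology of T^*M making the bundle charts z |-> (bcoord z c, coord z c)
   homeomorphisms onto open sets. *)
Definition bundle_open (A : set (covector M)) : Prop :=
  exists c, exists W : set ('rV[R]_d * 'rV[R]_d)%type,
    [/\ atlas c, open W &
        A = [set z | cdom c (base z) /\ W (bcoord z c, coord z c)]].

HB.instance Definition _ := @isSubBaseTopological.Build (covector M)
  (set (covector M)) bundle_open id.

End Cotangent.

(* T^*M with its Borel sigma-algebra. *)
Notation borel_cotangent M := (g_sigma_algebraType (@open (covector M))).

Section GeodesicFlow.
Variables (R : realType) (d : nat) (M : smoothManifold R d).
Variable g : riemannianMetric M.

(* p = |xi|_g^2 in the canonical coordinates given by the chart c. *)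
Definition p_in (c : chart R d M) (x xi : 'rV[R]_d) : R :=
  (xi *m invmx (gmx g c x) *m xi^T) 0 0.

Definition cosphere : set (covector M) :=
  [set z | forall c, atlas c -> cdom c (base z) ->
             p_in c (bcoord z c) (coord z c) = 1].

(* gamma is an integral curve of H_p on the open set of times I *)
Definition integral_curve (I : set R) (gamma : R -> covector M) :=
  forall t, I t -> {for t, continuous gamma} /\
    forall c, atlas c -> cdom c (base (gamma t)) ->
      let X := hamilton_field (p_in c) (bcoord (gamma t) c) (coord (gamma t) c) in
      is_derive t (1 : R) (fun s => bcoord (gamma s) c) X.1 /\
      is_derive t (1 : R) (fun s => coord (gamma s) c) X.2.

(* phi t = exp(t H_p); H_p is complete when M is compact. *)
Record is_flow (phi : R -> covector M -> covector M) : Prop := IsFlow {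
  flow0 : forall z, phi 0 z = z;
  flowD : forall s t z, phi (s + t) z = phi s (phi t z);
  flow_continuous : continuous (fun tz : R * covector M => phi tz.1 tz.2);
  flow_integral : forall z, integral_curve setT (fun t => phi t z) }.

End GeodesicFlow.

Section Restriction.
Variables (R : realType) (T : topologicalType).
Implicit Type nu : set T -> \bar R.

(* \1_E nu; this is [mrestr] without the measurability proof of E *)
Definition restr nu (E A : set T) : \bar R := nu (A `&` E).

Definition msupport nu : set T :=
  [set z | forall U : set T, open U -> U z -> (0 < nu U)%E].

End Restriction.

Section Hypersurface.
Variables (R : realType) (n : nat) (M : smoothManifold R n.+1).
Variable g : riemannianMetric M.
Variable H : set M.
Implicit Types (c : chart R n.+1 M) (z : covector M).

Local Notation E := 'rV[R]_n.+1.
Local Notation E' := 'rV[R]_n.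

(* x = (x', x_n): the normal coordinate x_n is the last one. *)
Definition tang (x : E) : E' := col' ord_max x.
Definition norm_coord (x : E) : R := x 0 ord_max.
Definition join (x' : E') (t : R) : E :=
  \row_i oapp (x' 0) t (unlift ord_max i).

Definition slice_chart c :=
  atlas c /\ forall x, cdom c x -> (H x <-> norm_coord (cmap c x) = 0).

(* Embedded, without boundary, not necessarily closed in M. *)
Definition hypersurface :=
  forall x, H x -> exists2 c, slice_chart c & cdom c x.

Definition cosphere_over : set (covector M) :=
  cosphere g `&` [set z | H (base z)].

(* Unit covectors xi whose g-dual vector is tangent to H, the tangent space
   of H being {v_n = 0} in slice charts. *)
Definition cosphere_of : set (covector M) :=
  cosphere_over `&`
  [set z | forall c, slice_chart c -> cdom c (base z) ->
     norm_coord (coord z c *m invmx (gmx g c (bcoord z c))) = 0].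

(* Fermi normal coordinates: (x', x_n) |-> exp_{x'} (x_n nu(x')) with nu a unit
   normal of H. A unit speed geodesic is s |-> base (zeta (s / 2)) for an
   integral curve zeta of H_p in S^*M, as p = |xi|^2 generates the geodesic
   flow at speed 2; zeta 0 is a unit conormal when it annihilates TH, i.e. when
   its tangential components vanish. *)
Definition fermi_chart c :=
  slice_chart c /\
  exists (V : set E') (eps : R),
    [/\ 0 < eps,
        ccod c = [set x | V (tang x) /\ `|norm_coord x| < eps] &
        forall x', V x' -> exists zeta : R -> covector M,
          [/\ integral_curve g [set s | `|2 * s| < eps] zeta,
              (forall s, `|2 * s| < eps -> cosphere g (zeta s)),
              tang (coord (zeta 0) c) = 0 &
              forall s, `|2 * s| < eps ->
                base (zeta s) = cinv c (join x' (2 * s))]].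

(* R_2(x', x_n, xi') = |xi'|^2 for the metric g_H(x', x_n) induced by g on the
   hypersurface {x_n = constant}. *)
Definition R2 c (x' : E') (xn : R) (xi' : E') : R :=
  (xi' *m invmx (row' ord_max (col' ord_max (gmx g c (join x' xn))))
       *m xi'^T) 0 0.

(* Q(0, x', xi'), the second fundamental form of H *)
Definition Q0 c (x' xi' : E') : R :=
  2^-1 * 'D_1 (fun xn : R => R2 c x' xn xi') 0.

Definition II_null : set (covector M) :=
  [set z | forall c, fermi_chart c -> cdom c (base z) ->
     Q0 c (tang (bcoord z c)) (tang (coord z c)) = 0].

(* H_p at z equals the Hamilton vector field of |xi'|^2_{g_H} on T^*H, in the
   canonical coordinates of Fermi charts, where T^*H = {x_n = 0, xi_n = 0}. *)
Definition fields_coincide : set (covector M) :=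
  [set z | forall c, fermi_chart c -> cdom c (base z) ->
     let X := hamilton_field (fun x' xi' => R2 c x' 0 xi')
                (tang (bcoord z c)) (tang (coord z c)) in
     hamilton_field (p_in g c) (bcoord z c) (coord z c)
       = (join X.1 0, join X.2 0)].

End Hypersurface.

(* Main.v *)
From Pilot Require Import Defs.
From HB Require Import structures.
From mathcomp Require Import all_boot all_order all_algebra.
From mathcomp Require Import all_classical all_reals all_analysis.
From mathcomp Require Import ring.

Set Implicit Arguments.
Unset Strict Implicit.
Unset Printing Implicit Defensive.

Import Order.TTheory GRing.Theory Num.Theory.
Import numFieldNormedType.Exports.
(* [coord] has to mean the coordinates of a covector, not those of a vector
   on a free family. *)
Import Pilot.Defs.

Local Open Scope classical_set_scope.
Local Open Scope ring_scope.

(** The theorem rests on one observation about a finite measure [mu] preserved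
    by a flow: a measurable set [A] whose points all leave [A] immediately, that
    is, [phi t z] is outside [A] for all small [t > 0], is null
    ([no_return_null]). Indeed, if the points of [A] stayed away for a uniform
    time, then the preimages of [A] under infinitely many flow times taken in
    that lapse would be pairwise disjoint sets of equal measure in a space of
    finite measure; and [A] is a countable union of such sets.

    The observation is applied to two sets of unit covectors over [H], whose
    points leave [H] immediately under the geodesic flow.

    Covectors that are not tangent to [H] ([transversal_null]): in a slice chart
    [x_n] vanishes on [H], and its time derivative [2 (xi g^-1)_n] is nonzero at
    time 0, so that [x_n] is nonzero right after. As being transversal is an
    open condition, the Borel measurability of the sets in play is a matter of
    opens and complements. This gives (1).

    Covectors tangent to [H] where [Q <> 0] ([support_II_null]): by the Gauss
    lemma ([fermi_frame]) the last row of the metric is [(0, .., 0, 1)] in a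
    Fermi chart, whence [p = R2 + xi_n^2], [x_n' = 2 xi_n] and
    [xi_n' = - d p / d x_n = - 2 Q] on [S^*H]. So [xi_n] starts at 0 with
    a nonzero derivative; it has no zero right after time 0, and by the mean
    value theorem neither has [x_n]. Since [Q <> 0] is an open condition, a
    point of [S^*H] where it holds has a neighbourhood whose trace on [S^*H] is
    null, and this point is not in the support. This gives (2).

    For (3), on [S^*H] one has [x_n = xi_n = 0], and the identity
    [p = R2 + xi_n^2] makes the Hamilton fields of [p] and of [R2] at [x_n = 0]
    agree except for the last component of momentum, which is [- 2 Q]
    ([fermi_hamilton]). *)

(** * Measure-preserving flows and sets without return *)

Section NoReturn.
Variables (d : measure_display) (T : measurableType d) (R : realType).
Variable mu : {finite_measure set T -> \bar R}.

Lemma disjoint_copies_null (A : set T) (E : (set T)^nat) :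
  (forall j, measurable (E j)) -> trivIset setT E ->
  (forall j, mu (E j) = mu A) -> measurable A -> mu A = 0%E.
Proof.
move=> mE tE muE mA.
have fA : mu A \is a fin_num by exact: fin_num_measure.
have fT : mu setT \is a fin_num by exact: fin_num_measure.
have bound N : fine (mu A) *+ N <= fine (mu setT).
  rewrite -lee_fin fineK//.
  have -> : (fine (mu A) *+ N)%:E = (\sum_(j < N) mu (E j))%E.
    under eq_bigr do rewrite muE -(fineK fA).
    by rewrite sumEFin sumr_const card_ord.
  rewrite -(@measure_bigsetU _ _ _ mu E mE)//.
  apply: le_measure => //; rewrite inE//.
  by apply: bigsetU_measurable => j _; exact: mE.
have A0 : 0 <= fine (mu A) by exact: fine_ge0.
rewrite -(fineK fA); congr EFin; apply/eqP; rewrite eq_le A0 andbT leNgt.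
apply/negP => A_gt0.
have [N NA] : exists N : nat, fine (mu setT) < fine (mu A) *+ N.
  exists (Num.bound (fine (mu setT) / fine (mu A))).
  rewrite -mulr_natl -ltr_pdivrMr//.
  apply: archi_boundP; rewrite divr_ge0// fine_ge0//.
by have := bound N; rewrite leNgt NA.
Qed.

Variable phi : R -> T -> T.
Hypothesis phiD : forall s t z, phi (s + t) z = phi s (phi t z).
Hypothesis phi_meas : forall t A, measurable A -> measurable (phi t @^-1` A).
Hypothesis phi_inv : forall t A, measurable A -> mu (phi t @^-1` A) = mu A.

(** The return times are controlled only along the countably many differences
    [tau j - tau k], [j < k], of the times [tau k = 1 / (k + 1)]. They suffice
    to make the preimages at the times [tau k] disjoint, and asking for no
    return at those with [j >= m] defines a measurable subset [B m] of [A]. *)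
Lemma no_return_null (A : set T) : measurable A ->
  (forall z, A z -> exists2 eps : R, 0 < eps &
     forall t, 0 < t < eps -> ~ A (phi t z)) ->
  mu A = 0%E.
Proof.
move=> mA Aret.
pose tau (k : nat) : R := k.+1%:R^-1.
have tau_gt0 k : 0 < tau k by rewrite invr_gt0.
have tau_decr j k : (j < k)%N -> tau k < tau j.
  by move=> jk; rewrite ltf_pV2 ?posrE// ltr_nat.
pose B m : set T := A `&` [set z | forall j k,
  (m <= j)%N -> (j < k)%N -> (~` (phi (tau j - tau k) @^-1` A)) z].
have mB m : measurable (B m).
  apply: measurableI => //.
  have -> : [set z | forall j k,
      (m <= j)%N -> (j < k)%N -> (~` (phi (tau j - tau k) @^-1` A)) z] =
    \bigcap_j \bigcap_(k in [set k | (m <= j)%N /\ (j < k)%N])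
      (~` (phi (tau j - tau k) @^-1` A)).
    apply/seteqP; split => z /= Hz j; first by move=> _ k [mj jk]; exact: Hz.
    by move=> k mj jk; exact: Hz.
  apply: bigcapT_measurable => j; apply: bigcap_measurableType => // k _.
  exact/measurableC/phi_meas.
have B0 m : mu (B m) = 0%E.
  apply: (@disjoint_copies_null _ (fun j => phi (tau (m + j)) @^-1` B m)) => //.
  - by move=> j; exact: phi_meas.
  - move=> j k _ _ [z [/= Bj Bk]].
    wlog jk : j k Bj Bk / (j < k)%N.
      by move=> W; have [/W->//|/W->//|//] := ltngtP j k.
    case: Bk => _ /(_ (m + j)%N (m + k)%N (leq_addr _ _)).
    rewrite ltn_add2l jk => /(_ isT) /=; rewrite -phiD subrK => nA.
    by case: nA; case: Bj.
  - by move=> j; exact: phi_inv.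
apply: measure_negligible mA _.
apply: (@negligibleS _ _ _ mu (\bigcup_m B m)); last first.
  apply: negligible_bigcup => m; exists (B m).
  by split; [exact: mB|exact: B0|exact: subset_refl].
move=> z Az; have [eps eps_gt0 epsP] := Aret z Az.
have [m mlt] : exists m, tau m < eps.
  exists (Num.bound eps^-1); rewrite /tau invf_plt ?posrE//.
  by apply: (lt_trans (archi_boundP _)); rewrite ?ltr_nat// invr_ge0 ltW.
exists m => //; split => // j k mj jk; apply: epsP.
rewrite subr_gt0 tau_decr//=; apply: lt_trans mlt.
rewrite (@lt_le_trans _ _ (tau j)) ?ltrBlDr ?ltrDl//.
by rewrite lef_pV2 ?posrE// ler_nat.
Qed.

End NoReturn.

(** * Limits of matrices *)

Section EntrywiseLimits.
Variables (R : numFieldType) (T : Type) (F : set_system T).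
Hypothesis FF : Filter F.

Lemma near_cvg_eq (f g : T -> R) (l : R) :
  (\forall x \near F, f x = g x) -> f x @[x --> F] --> l ->
  g x @[x --> F] --> l.
Proof. by move=> fg; apply: cvg_trans; exact: near_eq_cvg. Qed.

Lemma cvg_finsum (I : Type) (r : seq I) (P : pred I) (f : I -> T -> R)
    (l : I -> R) :
  (forall i, P i -> f i x @[x --> F] --> l i) ->
  \sum_(i <- r | P i) f i x @[x --> F] --> \sum_(i <- r | P i) l i.
Proof.
move=> fl; elim: r => [|i r IHr].
  rewrite big_nil; under eq_fun do rewrite big_nil; exact: cvg_cst.
rewrite big_cons; under eq_fun do rewrite big_cons.
by case: ifPn => // Pi; apply: cvgD => //; exact: fl.
Qed.

Lemma cvg_finprod (I : Type) (r : seq I) (P : pred I) (f : I -> T -> R)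
    (l : I -> R) :
  (forall i, P i -> f i x @[x --> F] --> l i) ->
  \prod_(i <- r | P i) f i x @[x --> F] --> \prod_(i <- r | P i) l i.
Proof.
move=> fl; elim: r => [|i r IHr].
  rewrite big_nil; under eq_fun do rewrite big_nil; exact: cvg_cst.
rewrite big_cons; under eq_fun do rewrite big_cons.
by case: ifPn => // Pi; apply: cvgM => //; exact: fl.
Qed.

(** Convergence is taken entry by entry, because the products below are
    expanded into sums of products of entries anyway. *)
Definition mx_cvg m n (A : T -> 'M[R]_(m, n)) (B : 'M[R]_(m, n)) :=
  forall i j, A x i j @[x --> F] --> B i j.

Lemma mx_cvg_cst m n (A : 'M[R]_(m, n)) : mx_cvg (fun=> A) A.
Proof. by move=> i j; exact: cvg_cst. Qed.

Lemma mx_cvg_tr m n (A : T -> 'M[R]_(m, n)) B :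
  mx_cvg A B -> mx_cvg (fun x => (A x)^T) B^T.
Proof.
move=> AB i j; rewrite mxE; under eq_fun do rewrite mxE; exact: AB.
Qed.

Lemma mx_cvg_mul m n p (A : T -> 'M[R]_(m, n)) A0 (B : T -> 'M[R]_(n, p)) B0 :
  mx_cvg A A0 -> mx_cvg B B0 -> mx_cvg (fun x => A x *m B x) (A0 *m B0).
Proof.
move=> AA0 BB0 i j; rewrite mxE; under eq_fun do rewrite mxE.
by apply: cvg_finsum => k _; apply: cvgM; [exact: AA0|exact: BB0].
Qed.

Lemma cvg_det n (A : T -> 'M[R]_n) B :
  mx_cvg A B -> \det (A x) @[x --> F] --> \det B.
Proof.
move=> AB; apply: cvg_finsum => s _; apply: cvgM; first exact: cvg_cst.
by apply: cvg_finprod => i _; exact: AB.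
Qed.

Lemma mx_cvg_adj n (A : T -> 'M[R]_n) B :
  mx_cvg A B -> mx_cvg (fun x => \adj (A x)) (\adj B).
Proof.
move=> AB i j; rewrite mxE; under eq_fun do rewrite mxE.
apply: cvgM; first exact: cvg_cst.
apply: cvg_det => k l; rewrite !mxE; under eq_fun do rewrite !mxE.
exact: AB.
Qed.

Lemma near_unitmx n (A : T -> 'M[R]_n) B :
  mx_cvg A B -> B \in unitmx -> \forall x \near F, A x \in unitmx.
Proof.
move=> AB; rewrite unitmxE unitfE => detB.
under eq_near do rewrite unitmxE unitfE.
exact: cvgr_neq0 (cvg_det AB) detB.
Qed.

(** By Cramer's formula the inverse is a continuous function of the entries,
    wherever the determinant is invertible. *)
Lemma mx_cvg_inv n (A : T -> 'M[R]_n) B :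
  mx_cvg A B -> B \in unitmx -> mx_cvg (fun x => invmx (A x)) (invmx B).
Proof.
move=> AB uB i j.
have eqA : \forall x \near F,
    (\det (A x))^-1 * (\adj (A x)) i j = invmx (A x) i j.
  near=> x.
  have uA : A x \in unitmx by near: x; exact: near_unitmx AB uB.
  by rewrite /invmx uA [RHS]mxE.
apply: near_cvg_eq eqA _.
have -> : invmx B i j = (\det B)^-1 * (\adj B) i j.
  by rewrite /invmx uB [LHS]mxE.
apply: cvgM; last exact: mx_cvg_adj.
apply: cvgV; last exact: cvg_det.
by move: uB; rewrite unitmxE unitfE.
Unshelve. all: by end_near. Qed.

End EntrywiseLimits.
Arguments mx_cvg_cst {R T F} FF {m n} A i j.
Arguments mx_cvg_tr {R T F m n A B} AB i j.
Arguments mx_cvg_mul {R T F} FF {m n p A A0 B B0} AA0 BB0 i j.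
Arguments mx_cvg_inv {R T F} FF {n A B} AB uB i j.

(** * Derivatives of quadratic forms *)

Section DerivativeAsLimit.
Variables (R : numFieldType) (V : normedModType R).

Lemma is_derive_cvg (W : normedModType R) (f : V -> W) (a v : V) (l : W) :
  h^-1 *: (f (h *: v + a) - f a) @[h --> (0 : R)^'] --> l -> is_derive a v f l.
Proof.
move=> fl; apply: DeriveDef; last exact: cvg_lim fl.
by apply/cvg_ex; exists l.
Qed.

Lemma cvg_is_derive (W : normedModType R) (f : V -> W) (a v : V) (l : W) :
  is_derive a v f l -> h^-1 *: (f (h *: v + a) - f a) @[h --> (0 : R)^'] --> l.
Proof. by move=> [df <-]. Qed.

Lemma cvg_along_derivable (f : V -> R) (a v : V) :
  derivable f a v -> f (h *: v + a) @[h --> (0 : R)^'] --> f a.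
Proof.
set l := 'D_v f a; move=> /derivableP dfP; have df := cvg_is_derive dfP.
have h0 : (fun h : R => h) @ (0 : R)^' --> (0 : R).
  exact: nbhs_dnbhs.
apply/subr_cvg0.
have E : \forall h \near (0 : R)^',
    h * (h^-1 *: (f (h *: v + a) - f a)) = f (h *: v + a) - f a.
  near=> h; rewrite /GRing.scale /= mulrA mulfV ?mul1r//.
  by near: h; exact: nbhs_dnbhs_neq.
have := cvgM h0 df; rewrite mul0r => L.
by refine (near_cvg_eq (dnbhs_filter _) E _); exact: (L _).
Unshelve. all: by end_near. Qed.

(** By the resolvent identity [A_h^-1 - A^-1 = - A_h^-1 (A_h - A) A^-1], the
    derivative of the inverse only requires the continuity of the inverse. *)
Lemma is_derive_quad_invmx n (G : V -> 'M[R]_n) (a v : V) (xi : 'rV[R]_n) :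
  G a \in unitmx -> (forall i j, derivable (fun x => G x i j) a v) ->
  is_derive a v (fun x => (xi *m invmx (G x) *m xi^T) 0 0)
    (- (xi *m invmx (G a) *m (\matrix_(i, j) 'D_v (fun x => G x i j) a)
        *m invmx (G a) *m xi^T) 0 0).
Proof.
move=> uG dG; apply: is_derive_cvg.
have Gcvg : mx_cvg ((0 : R)^') (fun h => G (h *: v + a)) (G a).
  by move=> i j; exact: cvg_along_derivable (dG i j).
have eqh : \forall h \near (0 : R)^',
   (xi *m - invmx (G (h *: v + a)) *m
      (\matrix_(i, j) (h^-1 *: (G (h *: v + a) i j - G a i j))) *m
      invmx (G a) *m xi^T) 0 0 =
   h^-1 *: ((xi *m invmx (G (h *: v + a)) *m xi^T) 0 0
            - (xi *m invmx (G a) *m xi^T) 0 0).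
  near=> h.
  have : G (h *: v + a) \in unitmx by near: h; exact: near_unitmx Gcvg uG.
  set Gh := G _ => uGh.
  have -> : (\matrix_(i, j) (h^-1 *: (Gh i j - G a i j))) = h^-1 *: (Gh - G a).
    by apply/matrixP => i j; rewrite !mxE.
  have res : - invmx Gh *m (Gh - G a) *m invmx (G a) = invmx Gh - invmx (G a).
    rewrite mulmxBr mulmxBl mulNmx mulVmx// mulNmx mulNmx mulNmx.
    by rewrite -mulmxA mulmxV// mulmx1 mul1mx opprK addrC.
  rewrite -scalemxAr -scalemxAl -scalemxAl mxE; congr (_ * _).
  rewrite -[in LHS](mulmxA xi) -[in LHS](mulmxA xi) res.
  by rewrite mulmxBr mulmxBl !mxE.
refine (near_cvg_eq (dnbhs_filter _) eqh _).
have -> : - (xi *m invmx (G a) *m (\matrix_(i, j) 'D_v (fun x => G x i j) a)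
        *m invmx (G a) *m xi^T) 0 0 =
   (xi *m - invmx (G a) *m (\matrix_(i, j) 'D_v (fun x => G x i j) a)
        *m invmx (G a) *m xi^T) 0 0.
  by rewrite mulmxN !mulNmx [in RHS]mxE.
apply: (_ : mx_cvg _ (fun h : R => xi *m - invmx (G (h *: v + a)) *m
  (\matrix_(i, j) (h^-1 *: (G (h *: v + a) i j - G a i j))) *m
  invmx (G a) *m xi^T) _).
have F0 := dnbhs_filter (0 : R).
refine (mx_cvg_mul F0 _ (mx_cvg_cst F0 _)).
refine (mx_cvg_mul F0 _ (mx_cvg_cst F0 _)).
refine (mx_cvg_mul F0 _ _).
  refine (mx_cvg_mul F0 (mx_cvg_cst F0 _) _).
  move=> i j; rewrite mxE; under eq_fun do rewrite mxE.
  by apply: cvgN; refine (mx_cvg_inv F0 Gcvg uG i j).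
move=> i j; rewrite mxE; under eq_fun do rewrite mxE.
exact: dG.
Unshelve. all: by end_near. Qed.

End DerivativeAsLimit.

Lemma is_derive_quad (R : numFieldType) n (B : 'M[R]_n) (xi v : 'rV[R]_n) :
  is_derive xi v (fun u => (u *m B *m u^T) 0 0)
    ((xi *m B *m v^T) 0 0 + (v *m B *m xi^T) 0 0).
Proof.
apply: is_derive_cvg.
have h0 : (fun h : R => h) @ (0 : R)^' --> (0 : R).
  exact: nbhs_dnbhs.
have lim : (xi *m B *m v^T) 0 0 + (v *m B *m xi^T) 0 0
    + h * (v *m B *m v^T) 0 0 @[h --> (0 : R)^'] -->
    (xi *m B *m v^T) 0 0 + (v *m B *m xi^T) 0 0.
  rewrite -[X in _ --> X]addr0; apply: cvgD; first exact: cvg_cst.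
  rewrite -[X in _ --> X](mul0r ((v *m B *m v^T) 0 0)).
  by apply: cvgM => //; exact: cvg_cst.
have E : \forall h \near (0 : R)^',
    (xi *m B *m v^T) 0 0 + (v *m B *m xi^T) 0 0 + h * (v *m B *m v^T) 0 0 =
    h^-1 *: (((h *: v + xi) *m B *m (h *: v + xi)^T) 0 0
             - (xi *m B *m xi^T) 0 0).
  near=> h; have hn0 : h != 0 by near: h; exact: nbhs_dnbhs_neq.
  have trE : (h *: v + xi)^T = h *: v^T + xi^T by rewrite linearP.
  rewrite trE !(mulmxDl, mulmxDr) -!scalemxAl -!scalemxAr -?scalemxAl.
  move: (xi *m B *m v^T) (v *m B *m xi^T) (v *m B *m v^T) (xi *m B *m xi^T).
  move=> p q r s; rewrite !mxE [RHS]/GRing.scale /=.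
  by apply: (mulfI hn0); rewrite [RHS]mulrA mulfV// mul1r; ring.
by refine (near_cvg_eq (dnbhs_filter _) E _).
Unshelve. all: by end_near. Qed.

(** * Functions of one variable and of one direction *)

Section OneVariable.
Variable R : realType.
Implicit Types (f : R -> R) (P : R -> Prop).

Lemma derive0_constant f (a b : R) : a <= b ->
  (forall t, a <= t <= b -> is_derive t (1 : R) f 0) -> f a = f b.
Proof.
move=> ab df; have [||t _ fE] := @MVT_segment _ f (fun=> 0) a b ab.
- move=> t; rewrite in_itv/= => /andP[/ltW at_ /ltW tb].
  by apply: df; rewrite at_.
- apply: derivable_within_continuous => t; rewrite in_itv/= => tab.
  by have [] := df _ tab.
- by apply/esym/eqP; rewrite -subr_eq0 fE mul0r.
Qed.

Lemma near_dnbhs_ne0 f (a : R) :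
  is_derive (0 : R) (1 : R) f a -> a != 0 -> f 0 = 0 ->
  \forall t \near (0 : R)^', f t != 0.
Proof.
move=> df a0 f0; have F0 := dnbhs_filter (0 : R).
have L := cvg_is_derive df.
near=> t; have : t^-1 *: (f (t *: (1 : R) + 0) - f 0) != 0.
  by near: t; exact: cvgr_neq0 L a0.
by apply: contra => /eqP ft; rewrite addr0 [_ *: 1]mulr1 ft f0 subr0 scaler0.
Unshelve. all: by end_near. Qed.

Lemma near_dnbhs_right P : (\forall t \near (0 : R)^', P t) ->
  exists2 e : R, 0 < e & forall t, 0 < t < e -> P t.
Proof.
move=> /nbhs_ballP[e /= e0 eP]; exists e => // t /andP[t0 te].
by apply: eP; [rewrite /ball/= sub0r normrN gtr0_norm|exact: lt0r_neq0].
Qed.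

End OneVariable.

Lemma is_derive_entry (R : realType) d (F : R -> 'rV[R]_d) t L i :
  is_derive t (1 : R) F L -> is_derive t (1 : R) (fun s => F s 0 i) (L 0 i).
Proof.
move=> [dM <-]; apply: DeriveDef; first exact: (derivable_mxP _ _ _).1 dM 0 i.
by rewrite derive_mx// mxE.
Qed.

(** Directional derivatives only see the restriction of a function to a line;
    this compares partial derivatives of functions on spaces of different
    dimensions. *)
Lemma derive_along (R : realType) (V W : normedModType R) (f : V -> R)
    (h : W -> R) (C : R) (x v : V) (y w : W) :
  (\forall t \near (0 : R), f (t *: v + x) = h (t *: w + y) + C) ->
  'D_v f x = 'D_w h y.
Proof.
move=> fh; have fh0 : f x = h y + C.
  by have := nbhs_singleton fh; rewrite !scale0r !add0r.
rewrite /derive; congr (lim _).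
have E : \forall t \near (0 : R)^', t^-1 *: ((f \o shift x) (t *: v) - f x) =
    t^-1 *: ((h \o shift y) (t *: w) - h y).
  apply: nbhs_dnbhs; move: fh; apply: filterS => t /= ->.
  by rewrite fh0 opprD addrACA subrr addr0.
apply/seteqP; split; refine (near_eq_cvg (FF := dnbhs_filter _) _) => //.
by near do apply/esym.
Unshelve. all: by end_near. Qed.

(** * Charts of the cotangent bundle *)

Section CotangentTopology.
Variables (R : realType) (d : nat) (M : smoothManifold R d).

Lemma open_bundle_open (A : set (covector M)) : bundle_open A -> open A.
Proof.
move=> bA; exists [set A]; last by rewrite bigcup_set1.
by move=> _ ->; exact: finI_from1.
Qed.

Lemma ccod_chart (c : chart R d M) : atlas c ->
  forall x, ccod c x -> cdom c (cinv c x) /\ cmap c (cinv c x) = x.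
Proof.
move=> /atlas_chart[_ _ cK _ _] x [w cw <-].
by rewrite cK.
Qed.

Lemma open_ccod (c : chart R d M) : atlas c -> open (ccod c).
Proof. by move=> /atlas_chart[]. Qed.

Lemma bcoord_ccod (c : chart R d M) (z : covector M) :
  cdom c (base z) -> ccod c (bcoord z c).
Proof. by move=> cz; exists (base z). Qed.

Lemma open_over_cdom (c : chart R d M) : atlas c ->
  open [set z : covector M | cdom c (base z)].
Proof.
move=> ac; apply: open_bundle_open; exists c, setT; split => //.
  exact: openT.
by apply/seteqP; split=> z //= [].
Qed.

End CotangentTopology.

(** * Hamilton's equations of the metric *)

Section Hamiltonian.
Variables (R : realType) (d : nat) (M : smoothManifold R d).
Variable g : riemannianMetric M.
Variable c : chart R d M.
Hypothesis ac : atlas c.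
Implicit Types (x xi v : 'rV[R]_d).

Lemma gmx_unit x : ccod c x -> gmx g c x \in unitmx.
Proof.
move=> cx; rewrite -row_free_unit; apply: inj_row_free => v vG.
apply/eqP; apply: contraT => /(gmx_pos g ac cx).
by rewrite vG mul0mx mxE ltxx.
Qed.

Lemma invmx_gmx_sym x : ccod c x -> (invmx (gmx g c x))^T = invmx (gmx g c x).
Proof. by move=> cx; rewrite trmx_inv gmx_sym. Qed.

Lemma gmx_differentiable i j x : ccod c x ->
  differentiable (fun y => gmx g c y i j) x.
Proof. by move=> cx; have [+ _] := gmx_smooth g ac i j 1%N; exact. Qed.

Definition dgmx v x : 'M[R]_d := \matrix_(i, j) 'D_v (fun y => gmx g c y i j) x.

Lemma gmx_continuous x : ccod c x -> mx_cvg (nbhs x) (gmx g c) (gmx g c x).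
Proof.
move=> cx i j.
exact: differentiable_continuous (gmx_differentiable i j cx).
Qed.
Arguments gmx_continuous {x} cx i j.

Lemma dgmx_continuous k x : ccod c x ->
  mx_cvg (nbhs x) (dgmx (delta_mx 0 k)) (dgmx (delta_mx 0 k) x).
Proof.
move=> cx i j; rewrite mxE; under eq_fun do rewrite mxE.
by have [_ /(_ k)] := gmx_smooth g ac i j 1%N; apply.
Qed.
Arguments dgmx_continuous k {x} cx i j.

(** Half of Hamilton's equations: [d p / d xi_i] is twice the [i]-th coordinate
    of the vector dual to [xi], by the symmetry of the metric. *)
Lemma derive_p_fiber x xi i : ccod c x ->
  'D_(delta_mx 0 i) (p_in g c x) xi = 2 * (xi *m invmx (gmx g c x)) 0 i.
Proof.
move=> cx; pose e : 'rV[R]_d := delta_mx 0 i; rewrite -/e.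
have dq := is_derive_quad (invmx (gmx g c x)) xi e.
rewrite derive_val.
have -> : (e *m invmx (gmx g c x) *m xi^T) 0 0 =
    (xi *m invmx (gmx g c x) *m e^T) 0 0.
  transitivity ((e *m invmx (gmx g c x) *m xi^T)^T 0 0).
    by rewrite [RHS]mxE.
  by rewrite !trmx_mul trmxK invmx_gmx_sym// mulmxA.
by rewrite /e trmx_delta -colE mxE; ring.
Qed.

(** The derivative of [x |-> p (x, xi)] along [v], in the form
    [- xi g^-1 (d_v g) g^-1 xi^T], which is continuous in [(x, xi)] and depends
    on [xi] through the dual vector [xi g^-1] only. *)
Definition dp_base x xi v : R :=
  - (xi *m invmx (gmx g c x) *m dgmx v x *m invmx (gmx g c x) *m xi^T) 0 0.

Lemma is_derive_p_base x xi v : ccod c x ->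
  is_derive x v ((p_in g c)^~ xi) (dp_base x xi v).
Proof.
move=> cx; apply: is_derive_quad_invmx; first exact: gmx_unit.
by move=> i j; apply: diff_derivable; exact: gmx_differentiable.
Qed.

Lemma derive_p_base x xi v : ccod c x ->
  'D_v ((p_in g c)^~ xi) x = dp_base x xi v.
Proof. by move=> /is_derive_p_base dpx; rewrite derive_val. Qed.

Section IntegralCurve.
Variables (I : set R) (gamma : R -> covector M).
Hypothesis gammaP : integral_curve g I gamma.

Lemma derive_position t i : I t -> cdom c (base (gamma t)) ->
  is_derive t (1 : R) (fun s => bcoord (gamma s) c 0 i)
    (2 * (coord (gamma t) c *m invmx (gmx g c (bcoord (gamma t) c))) 0 i).
Proof.
move=> It ct; have [_ /(_ c ac ct)/= [dx _]] := gammaP It.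
have := is_derive_entry i dx; rewrite mxE derive_p_fiber//.
exact: bcoord_ccod.
Qed.

Lemma derive_momentum t i : I t -> cdom c (base (gamma t)) ->
  is_derive t (1 : R) (fun s => coord (gamma s) c 0 i)
    (- dp_base (bcoord (gamma t) c) (coord (gamma t) c) (delta_mx 0 i)).
Proof.
move=> It ct; have [_ /(_ c ac ct)/= [_ dxi]] := gammaP It.
have := is_derive_entry i dxi; rewrite mxE mxE derive_p_base//.
exact: bcoord_ccod.
Qed.

End IntegralCurve.

(** The source of the open conditions below, all of which say that a
    continuous expression in [(x, xi)] does not vanish. *)
Lemma open_coord_ne0 (F : 'rV[R]_d -> 'rV[R]_d -> R) :
  (forall x xi, ccod c x -> F y.1 y.2 @[y --> (x, xi)] --> F x xi) ->
  open [set z : covector M | cdom c (base z) /\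
         F (bcoord z c) (coord z c) != 0].
Proof.
move=> Fcont; apply: open_bundle_open.
exists c, [set y | ccod c y.1 /\ F y.1 y.2 != 0]; split => //.
  rewrite openE => -[x xi] /= [cx Fx]; apply: filterI.
    exists (ccod c, setT) => [|[y1 y2] []//]; split; last exact: filterT.
    exact: open_nbhs_nbhs (conj (open_ccod ac) cx).
  exact: cvgr_neq0 (Fcont _ _ cx) Fx.
apply/seteqP; split => z /= [cz Fz]; split => //; last by case: Fz.
by split => //; exact: bcoord_ccod.
Qed.

Lemma mx_cvg_fst m k (A : 'rV[R]_d -> 'M[R]_(m, k)) x xi :
  mx_cvg (nbhs x) A (A x) ->
  mx_cvg (nbhs (x, xi)) (fun y : 'rV[R]_d * 'rV[R]_d => A y.1) (A x).
Proof.
move=> Ax i j.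
exact: (cvg_comp (G := nbhs x) fst (fun y => A y i j) cvg_fst (Ax i j)).
Qed.
Arguments mx_cvg_fst {m k A x} xi cA i j.

Lemma mx_cvg_snd x xi :
  mx_cvg (nbhs (x, xi)) (fun y : 'rV[R]_d * 'rV[R]_d => y.2) xi.
Proof.
move=> i j; exact: (cvg_comp (G := nbhs xi) snd (fun y : 'rV[R]_d => y i j)
  cvg_snd (@coord_continuous _ _ _ i j xi)).
Qed.
Arguments mx_cvg_snd : clear implicits.

Lemma invmx_gmx_continuous x : ccod c x ->
  mx_cvg (nbhs x) (fun y => invmx (gmx g c y)) (invmx (gmx g c x)).
Proof.
move=> cx i j; refine (mx_cvg_inv _ (gmx_continuous cx) (gmx_unit cx) i j).
Qed.
Arguments invmx_gmx_continuous {x} cx i j.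

Lemma open_velocity_ne0 i : open [set z : covector M | cdom c (base z) /\
  (coord z c *m invmx (gmx g c (bcoord z c))) 0 i != 0].
Proof.
apply: (open_coord_ne0 (F := fun x xi => (xi *m invmx (gmx g c x)) 0 i)).
move=> x xi cx; refine (mx_cvg_mul _ (mx_cvg_snd x xi) _ 0 i).
exact: mx_cvg_fst xi (invmx_gmx_continuous cx).
Qed.

Lemma open_p_ne1 : open [set z : covector M | cdom c (base z) /\
  p_in g c (bcoord z c) (coord z c) != 1].
Proof.
under eq_set do rewrite -subr_eq0.
apply: (open_coord_ne0 (F := fun x xi => p_in g c x xi - 1)).
move=> x xi cx; apply: cvgB; last exact: cvg_cst.
refine (mx_cvg_mul _ _ (mx_cvg_tr (mx_cvg_snd x xi)) 0 0).
refine (mx_cvg_mul _ (mx_cvg_snd x xi) _).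
exact: mx_cvg_fst xi (invmx_gmx_continuous cx).
Qed.

Lemma open_dp_ne0 k : open [set z : covector M | cdom c (base z) /\
  dp_base (bcoord z c) (coord z c) (delta_mx 0 k) != 0].
Proof.
apply: (open_coord_ne0 (F := fun x xi => dp_base x xi (delta_mx 0 k))).
move=> x xi cx; apply: cvgN.
have iG := mx_cvg_fst xi (invmx_gmx_continuous cx).
refine (mx_cvg_mul _ _ (mx_cvg_tr (mx_cvg_snd x xi)) 0 0).
refine (mx_cvg_mul _ _ iG).
refine (mx_cvg_mul _ (mx_cvg_mul _ (mx_cvg_snd x xi) iG) _).
exact: mx_cvg_fst xi (dgmx_continuous k cx).
Qed.

Lemma open_norm_coord_ne0 i : open [set z : covector M | cdom c (base z) /\
  bcoord z c 0 i != 0].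
Proof.
apply: (open_coord_ne0 (F := fun x xi => x 0 i)) => x xi cx.
exact: (cvg_comp (G := nbhs x) fst (fun y : 'rV[R]_d => y 0 i)
  cvg_fst (@coord_continuous _ _ _ 0 i x)).
Qed.

End Hamiltonian.

(** * Normal and tangential components *)

Section Splitting.
Variables (R : realType) (n : nat).
Implicit Types (x xi v : 'rV[R]_n.+1) (u : 'rV[R]_n) (G : 'M[R]_n.+1).

Lemma join_max u t : join u t 0 ord_max = t.
Proof. by rewrite mxE unlift_none. Qed.

Lemma join_lift u t j : join u t 0 (lift ord_max j) = u 0 j.
Proof. by rewrite mxE liftK. Qed.

Lemma tang_join u t : tang (join u t) = u.
Proof. by apply/rowP => j; rewrite mxE join_lift. Qed.

Lemma join_tang x : join (tang x) (norm_coord x) = x.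
Proof.
apply/rowP => i; case: (unliftP ord_max i) => [j|] ->; last exact: join_max.
by rewrite join_lift mxE.
Qed.

Lemma tangE x j : tang x 0 j = x 0 (lift ord_max j).
Proof. by rewrite mxE. Qed.

Lemma tang_shift t j x :
  tang (t *: delta_mx 0 (lift ord_max j) + x) = t *: delta_mx 0 j + tang x.
Proof.
apply/rowP => k; rewrite !mxE !eqxx/=.
by rewrite (inj_eq (@lift_inj _ ord_max)).
Qed.

Lemma norm_shift t j x :
  norm_coord (t *: delta_mx 0 (lift ord_max j) + x) = norm_coord x.
Proof.
rewrite /norm_coord !mxE eqxx/= (negPf (neq_lift _ _)) mulr0 add0r.
by [].
Qed.

Lemma tang_shift_max t x : tang (t *: delta_mx 0 ord_max + x) = tang x.
Proof.
apply/rowP => k; rewrite !mxE eqxx/= eq_sym (negPf (neq_lift _ _)).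
by rewrite mulr0 add0r.
Qed.

Lemma norm_shift_max t x :
  norm_coord (t *: delta_mx 0 ord_max + x) = t + norm_coord x.
Proof. by rewrite /norm_coord !mxE !eqxx/= mulr1. Qed.

Definition tang_block G := row' ord_max (col' ord_max G).

(** The shape of the metric in a Fermi chart: the last coordinate vector has
    length 1 and is orthogonal to the other ones. *)
Definition orthogonal_frame G :=
  G^T = G /\ forall j, G ord_max j = (j == ord_max)%:R.

Lemma join_mul u t G : orthogonal_frame G ->
  join u t *m G = join (u *m tang_block G) t.
Proof.
move=> [Gsym Gmax]; apply/rowP => i.
rewrite mxE (bigD1_ord ord_max)//= join_max Gmax; case: (unliftP ord_max i) => [j|] ->.
  rewrite join_lift eq_sym (negPf (neq_lift _ _)) mulr0 add0r mxE.
  by apply: eq_bigr => k _; rewrite join_lift !mxE.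
rewrite join_max eqxx mulr1 big1 ?addr0// => k _.
have -> : G (lift ord_max k) ord_max = 0.
  by rewrite -Gsym mxE Gmax eq_sym (negPf (neq_lift _ _)).
by rewrite mulr0.
Qed.

Lemma tang_block_unit G : orthogonal_frame G -> G \in unitmx ->
  tang_block G \in unitmx.
Proof.
move=> fG uG; rewrite -row_free_unit; apply: inj_row_free => u uG0.
have : join u 0 *m G = 0.
  rewrite join_mul// uG0; apply/rowP => i; rewrite [RHS]mxE.
  by case: (unliftP ord_max i) => [j|] ->; rewrite ?join_lift ?join_max// mxE.
move=> /(congr1 (fun A => A *m invmx G)); rewrite mulmxK// mul0mx => u0.
by apply/rowP => j; rewrite -(join_lift u 0) u0 !mxE.
Qed.

Lemma mul_invmx_frame xi G : orthogonal_frame G -> G \in unitmx ->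
  xi *m invmx G = join (tang xi *m invmx (tang_block G)) (norm_coord xi).
Proof.
move=> fG uG; rewrite -[RHS](mulmxK uG).
by rewrite join_mul// mulmxKV ?join_tang// tang_block_unit.
Qed.

(** Inverting a matrix in this shape amounts to inverting its tangential block,
    which separates the normal momentum from the tangential one. *)
Lemma quad_frame xi G : orthogonal_frame G -> G \in unitmx ->
  (xi *m invmx G *m xi^T) 0 0 =
  (tang xi *m invmx (tang_block G) *m (tang xi)^T) 0 0 + norm_coord xi ^+ 2.
Proof.
move=> fG uG; rewrite mul_invmx_frame// mxE (bigD1_ord ord_max)//= join_max.
rewrite addrC; congr (_ + _); last by rewrite mxE.
rewrite [RHS]mxE; apply: eq_bigr => j _.
by rewrite join_lift [xi^T _ _]mxE [_^T j 0]mxE tangE.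
Qed.

End Splitting.

(** * Fermi charts *)

Section Fermi.
Variables (R : realType) (n : nat) (M : smoothManifold R n.+1).
Variables (g : riemannianMetric M) (H : set M) (c : chart R n.+1 M).
Hypothesis fc : fermi_chart g H c.
Local Notation emax := (delta_mx 0 ord_max : 'rV[R]_n.+1).

Let ac : atlas c. Proof. by have [[]] := fc. Qed.

(** Along a curve [s |-> (x', 2 s)] the velocity is [2 e_n], and Hamilton's
    equation [x' = 2 xi g^-1] then determines the momentum. *)
Lemma normal_geodesic_momentum (zeta : R -> covector M) (I : set R)
    (x' : 'rV[R]_n) :
  open I -> integral_curve g I zeta ->
  (forall s, I s ->
     cdom c (base (zeta s)) /\ bcoord (zeta s) c = join x' (2 * s)) ->
  forall s, I s ->
   coord (zeta s) c *m invmx (gmx g c (join x' (2 * s))) = emax.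
Proof.
move=> oI zetaI zetaE s Is; have [cs bs] := zetaE s Is.
apply/rowP => i; have dx := derive_position ac zetaI i Is cs.
have nearI : \forall r \near s, I r by exact: open_nbhs_nbhs.
have nearE : \forall r \near s, bcoord (zeta r) c 0 i = join x' (2 * r) 0 i.
  by move: nearI; apply: filterS => r /zetaE[_ ->].
have := near_eq_is_derive nearE dx; rewrite bs => dj.
apply: (@mulfI _ (2 : R)); first by rewrite pnatr_eq0.
rewrite -(@derive_val _ _ _ _ _ _ _ dj).
case: (unliftP ord_max i) => [j|] ->.
  have -> : (fun r : R => join x' (2 * r) 0 (lift ord_max j)) = cst (x' 0 j).
    by apply/funext => r; rewrite join_lift.
  by rewrite derive_cst mxE eqxx eq_sym (negPf (neq_lift _ _)) mulr0.
have -> : (fun r : R => join x' (2 * r) 0 ord_max) = 2 \*: id.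
  by apply/funext => r; rewrite join_max.
by rewrite deriveZ// derive_id mxE !eqxx.
Qed.

(** The Gauss lemma. Along the normal geodesics [xi g^-1 = e_n], that is,
    [xi] is the last row of [g]. Then [p = 1] reads [g_nn = 1]; as this holds on
    the whole chart, [xi_j' = - d_j p = d_j g_nn = 0], so that
    [g_nj = xi_j] keeps its value 0 at [x_n = 0] for [j < n]. *)
Lemma fermi_frame x : ccod c x -> orthogonal_frame (gmx g c x).
Proof.
have [_ [V [eps [eps0 ccodE geod]]]] := fc.
(* The times of the normal geodesics, which have speed 2. *)
pose I : set R := [set s | `|2 * s| < eps].
have oI : open I.
  apply: (@open_comp _ _ (fun s : R => `|2 * s|) [set y | y < eps]).
    move=> s _; apply: continuous_comp; last exact: norm_continuous.
    exact: mulrl_continuous.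
  exact: open_lt.
have geodP x' zeta : V x' ->
    (forall s, I s -> base (zeta s) = cinv c (join x' (2 * s))) ->
    forall s, I s -> ccod c (join x' (2 * s)) /\
      (cdom c (base (zeta s)) /\ bcoord (zeta s) c = join x' (2 * s)).
  move=> Vx' zetaE s Is; have cs : ccod c (join x' (2 * s)).
    by rewrite ccodE/= tang_join /norm_coord join_max.
  by have [] := ccod_chart ac cs; rewrite -zetaE.
have param y : ccod c y -> exists x' s, [/\ V x', I s & y = join x' (2 * s)].
  rewrite ccodE => -[Vy ey]; exists (tang y), (norm_coord y / 2); split => //.
    by rewrite /I/= mulrC divfK// pnatr_eq0.
  by rewrite mulrC divfK ?pnatr_eq0// join_tang.
have rowG x' zeta : V x' -> integral_curve g I zeta ->
    (forall s, I s -> base (zeta s) = cinv c (join x' (2 * s))) ->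
    forall s, I s ->
      coord (zeta s) c *m invmx (gmx g c (join x' (2 * s))) = emax /\
      coord (zeta s) c = emax *m gmx g c (join x' (2 * s)).
  move=> Vx' zI zE s Is; have [cs _] := geodP _ _ Vx' zE _ Is.
  have XB := normal_geodesic_momentum oI zI
    (fun r Ir => (geodP _ _ Vx' zE r Ir).2) Is.
  by split => //; rewrite -XB mulmxKV// gmx_unit.
have Gmm y : ccod c y -> gmx g c y ord_max ord_max = 1.
  move=> /param[x' [s [Vx' Is ->]]].
  have [zeta [zI zS z0 zE]] := geod _ Vx'.
  have [XB Xc] := rowG _ _ Vx' zI zE _ Is.
  have [_ [cs bs]] := geodP _ _ Vx' zE _ Is.
  have := zS s Is c ac cs; rewrite /p_in bs XB Xc trmx_mul gmx_sym//; last first.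
    by have [] := geodP _ _ Vx' zE _ Is.
  by rewrite mulmxA -rowE trmx_delta -colE !mxE.
move=> cx; split; first exact: gmx_sym.
move=> i; case: (unliftP ord_max i) => [j|] ->; last by rewrite Gmm// eqxx.
rewrite eq_sym (negPf (neq_lift _ _)) -[RHS]/(0 : R).
have [x' [s [Vx' Is xE]]] := param _ cx.
have [zeta [zI zS z0 zE]] := geod _ Vx'.
have dcoord r : I r ->
    is_derive r (1 : R) (fun q => coord (zeta q) c 0 (lift ord_max j)) 0.
  move=> Ir; have [cr [cdr br]] := geodP _ _ Vx' zE _ Ir.
  have [XB _] := rowG _ _ Vx' zI zE _ Ir.
  apply: is_derive_eq (derive_momentum ac zI (lift ord_max j) Ir cdr) _.
  rewrite /dp_base br XB opprK -mulmxA.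
  have -> : invmx (gmx g c (join x' (2 * r))) *m (coord (zeta r) c)^T = emax^T.
    by rewrite -XB trmx_mul invmx_gmx_sym.
  rewrite trmx_delta -rowE -colE !mxE.
  have G1 : \forall y \near join x' (2 * r),
      gmx g c y ord_max ord_max = cst (1 : R) y.
    have : \forall y \near join x' (2 * r), ccod c y.
      by apply: open_nbhs_nbhs; split => //; exact: open_ccod.
    by apply: filterS => y /Gmm.
  by rewrite (near_eq_derive _ G1) derive_cst.
have [_ Xs] := rowG _ _ Vx' zI zE _ Is.
have <- : coord (zeta s) c 0 (lift ord_max j) =
    gmx g c x ord_max (lift ord_max j).
  by rewrite Xs -rowE mxE xE.
have <- : coord (zeta 0) c 0 (lift ord_max j) = 0 by rewrite -tangE z0 mxE.
have I_between q : (0 <= q <= s) || (s <= q <= 0) -> I q.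
  move=> qs; apply: le_lt_trans Is; rewrite !normrM ler_wpM2l//.
  by case/orP: qs => /andP[q1 q2];
    [rewrite !ger0_norm|rewrite !ler0_norm ?lerN2]; rewrite //; apply: le_trans q2.
pose f q := coord (zeta q) c 0 (lift ord_max j).
rewrite -/(f s) -/(f 0); have [s0|/ltW s0] := lerP 0 s.
  apply/esym; apply: (derive0_constant s0) => q qs.
  by apply/dcoord/I_between; rewrite qs.
apply: (derive0_constant s0) => q qs.
by apply/dcoord/I_between; rewrite qs orbT.
Qed.

Lemma fermi_p x xi : ccod c x ->
  p_in g c x xi = R2 g c (tang x) (norm_coord x) (tang xi) + norm_coord xi ^+ 2.
Proof.
move=> cx; rewrite /p_in quad_frame//; [|exact: fermi_frame|exact: gmx_unit].
by rewrite /R2 join_tang.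
Qed.

Lemma fermi_velocity x xi : ccod c x ->
  (xi *m invmx (gmx g c x)) 0 ord_max = norm_coord xi.
Proof.
move=> cx; rewrite mul_invmx_frame ?join_max//; last exact: gmx_unit.
exact: fermi_frame.
Qed.

Lemma near_ccod_line x v : ccod c x ->
  \forall t \near (0 : R), ccod c (t *: v + x).
Proof.
move=> cx; have : (fun t : R => t *: v + x) @ 0 --> x.
  have := cvgD (@scalel_continuous _ _ v 0) (cvg_cst x).
  by rewrite scale0r add0r; apply.
by apply; apply: open_nbhs_nbhs; split => //; exact: open_ccod.
Qed.

(** As [R2] and [p] differ by [xi_n^2], they have the same derivative in [x_n];
    the factor 2 comes from the normalisation of [Q]. *)
Lemma fermi_Q0 x xi : ccod c x -> norm_coord x = 0 ->
  dp_base g c x xi emax = 2 * Q0 g c (tang x) (tang xi).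
Proof.
move=> cx x0; rewrite -derive_p_base// /Q0 mulVKf ?pnatr_eq0//.
apply: (derive_along (C := norm_coord xi ^+ 2)).
have := near_ccod_line emax cx; apply: filterS => t ct.
by rewrite fermi_p// tang_shift_max norm_shift_max x0 [_ *: 1]mulr1.
Qed.

Lemma fermi_hamilton x xi :
  ccod c x -> norm_coord x = 0 -> norm_coord xi = 0 ->
  Q0 g c (tang x) (tang xi) = 0 ->
  let X := hamilton_field (fun x' xi' => R2 g c x' 0 xi') (tang x) (tang xi) in
  hamilton_field (p_in g c) x xi = (join X.1 0, join X.2 0).
Proof.
move=> cx x0 xi0 Q00 /=; congr (_, _); apply/rowP => i.
  rewrite mxE; case: (unliftP ord_max i) => [j|] ->; last first.
    by rewrite join_max derive_p_fiber// fermi_velocity// xi0 mulr0.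
  rewrite join_lift mxE; apply: (derive_along (C := norm_coord xi ^+ 2)).
  by near=> t; rewrite fermi_p// tang_shift norm_shift x0.
rewrite 2!mxE; case: (unliftP ord_max i) => [j|] ->; last first.
  by rewrite join_max derive_p_base// fermi_Q0// Q00 mulr0 oppr0.
rewrite join_lift 2!mxE; congr (- _).
apply: (derive_along (C := norm_coord xi ^+ 2)).
have := near_ccod_line (delta_mx 0 (lift ord_max j)) cx; apply: filterS => t ct.
by rewrite fermi_p// tang_shift norm_shift x0.
Unshelve. all: by end_near. Qed.

End Fermi.

(** * Integral curves leaving the hypersurface *)

Section LeavingHypersurface.
Variables (R : realType) (n : nat) (M : smoothManifold R n.+1).
Variables (g : riemannianMetric M) (H : set M) (c : chart R n.+1 M).
Variable gamma : R -> covector M.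
Hypothesis gammaP : integral_curve g setT gamma.
Hypothesis c0 : cdom c (base (gamma 0)).
Local Notation emax := (delta_mx 0 ord_max : 'rV[R]_n.+1).

Lemma near_cdom : atlas c -> \forall t \near (0 : R), cdom c (base (gamma t)).
Proof.
move=> ac; have [gamma_cont _] := gammaP (t := 0) I.
have /gamma_cont : nbhs (gamma 0) [set z | cdom c (base z)].
  by apply: open_nbhs_nbhs; split => //; exact: open_over_cdom.
exact.
Qed.

Lemma leaves_transversally : slice_chart H c -> H (base (gamma 0)) ->
  (coord (gamma 0) c *m invmx (gmx g c (bcoord (gamma 0) c))) 0 ord_max != 0 ->
  exists2 e : R, 0 < e & forall t, 0 < t < e -> ~ H (base (gamma t)).
Proof.
move=> [ac Hc] H0 v0; apply: near_dnbhs_right.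
have v20 : 2 * (coord (gamma 0) c *m
    invmx (gmx g c (bcoord (gamma 0) c))) 0 ord_max != 0.
  by rewrite mulf_neq0// pnatr_eq0.
have xn := near_dnbhs_ne0 (derive_position ac gammaP ord_max I c0) v20
  (proj1 (Hc _ c0) H0).
have F0 := dnbhs_filter (0 : R).
near=> t; have ct : cdom c (base (gamma t)).
  by near: t; apply: nbhs_dnbhs; exact: near_cdom.
move=> /(Hc _ ct) xt; have : bcoord (gamma t) c 0 ord_max != 0 by near: t.
by move/eqP; apply.
Unshelve. all: by end_near. Qed.

(** The normal momentum [xi_n] vanishes at time 0 with the nonzero derivative
    [- d p / d x_n], hence is nonzero right after; [x_n' = 2 xi_n] and the mean
    value theorem carry this over to [x_n]. *)
Lemma leaves_tangentially : fermi_chart g H c -> H (base (gamma 0)) ->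
  norm_coord (coord (gamma 0) c) = 0 ->
  dp_base g c (bcoord (gamma 0) c) (coord (gamma 0) c) emax != 0 ->
  exists2 e : R, 0 < e & forall t, 0 < t < e -> ~ H (base (gamma t)).
Proof.
move=> fc H0 xi0 dp0; have [[ac Hc] _] := fc.
have Ndp0 : - dp_base g c (bcoord (gamma 0) c) (coord (gamma 0) c) emax != 0.
  by rewrite oppr_eq0.
have xin := near_dnbhs_ne0 (derive_momentum ac gammaP ord_max I c0) Ndp0 xi0.
have F0 := dnbhs_filter (0 : R).
have : \forall t \near (0 : R)^', cdom c (base (gamma t)) /\
    coord (gamma t) c 0 ord_max != 0.
  near=> t; split; last by near: t.
  by near: t; apply: nbhs_dnbhs; exact: near_cdom.
move=> /near_dnbhs_right[e e0 eP]; exists e => // t /andP[t0 te].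
have dx r : 0 <= r <= t -> is_derive r (1 : R)
    (fun s => bcoord (gamma s) c 0 ord_max) (2 * coord (gamma r) c 0 ord_max).
  move=> /andP[r0 rt]; have cr : cdom c (base (gamma r)).
    move: r0; rewrite le_eqVlt => /predU1P[<-//|r0].
    by apply: (eP r _).1; rewrite r0 (le_lt_trans rt).
  have := derive_position ac gammaP ord_max I cr.
  by rewrite (fermi_velocity fc)//; exact: bcoord_ccod.
have [||r rt xt] := @MVT _ (fun s => bcoord (gamma s) c 0 ord_max)
  (fun r => 2 * coord (gamma r) c 0 ord_max) 0 t t0.
- move=> r; rewrite in_itv/= => /andP[/ltW r0 /ltW rt].
  by apply: dx; rewrite r0.
- apply: derivable_within_continuous => r; rewrite in_itv/= => rt.
  by have [] := dx _ rt.
have [ct _] := eP t (introT andP (conj t0 te)).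
move=> /(Hc _ ct) xt0; move: rt; rewrite in_itv/= => /andP[r0 rt].
have [_ xir] := eP r (introT andP (conj r0 (lt_trans rt te))).
move: xt; rewrite subr0 [X in _ - X](proj1 (Hc _ c0) H0) subr0.
rewrite [LHS]xt0 => /esym/eqP; rewrite !mulf_eq0 pnatr_eq0/= (negPf xir)/=.
by rewrite gt_eqF.
Unshelve. all: by end_near. Qed.

End LeavingHypersurface.

(** * Borel sets of covectors *)

Section BorelSets.
Variables (R : realType) (n : nat) (M : smoothManifold R n.+1).
Variables (g : riemannianMetric M) (H : set M).
Local Notation T := (borel_cotangent M).

Lemma open_measurable_cotangent (A : set (covector M)) :
  open A -> measurable (A : set T).
Proof. by move=> oA; exact: sub_sigma_algebra. Qed.

Lemma open_exists_chart (D : set (chart R n.+1 M))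
    (P : chart R n.+1 M -> set (covector M)) :
  (forall c, D c -> open (P c)) -> open [set z | exists2 c, D c & P c z].
Proof. by move=> oP; exact: bigcup_open. Qed.

Lemma measurable_cosphere : measurable (cosphere g : set T).
Proof.
rewrite -[cosphere g]setCK; apply: measurableC.
apply: open_measurable_cotangent.
have -> : ~` cosphere g = [set z | exists2 c, atlas c & cdom c (base z) /\
    p_in g c (bcoord z c) (coord z c) != 1].
  apply/seteqP; split => z /=.
    move=> nz; apply: contrapT => Hz; apply: nz => c ac cz; apply/eqP.
    by apply: contraT => pz; case: Hz; exists c.
  by move=> [c ac [cz /eqP pz]] Sz; apply: pz; exact: Sz.
by apply: open_exists_chart => c ac; exact: open_p_ne1.
Qed.

Hypothesis hypH : hypersurface H.

(** An embedded hypersurface is the complement, in the union of the domains of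
    slice charts, of the open set where some [x_n] is nonzero. *)
Lemma measurable_over_hypersurface : measurable ([set z | H (base z)] : set T).
Proof.
have -> : [set z : covector M | H (base z)] =
    [set z | exists2 c, slice_chart H c & cdom c (base z)] `&`
    ~` [set z | exists2 c, slice_chart H c & cdom c (base z) /\
       bcoord z c 0 ord_max != 0].
  apply/seteqP; split => z /=.
    move=> Hz; split; first exact: hypH.
    by move=> [c [ac Hc] [cz /eqP]]; apply; exact/(Hc _ cz).
  move=> [[c sc cz] nz]; apply/(sc.2 _ cz)/eqP; apply: contraT => xz.
  by case: nz; exists c.
apply: measurableI; last apply: measurableC; apply: open_measurable_cotangent.
  by apply: open_exists_chart => c [ac _]; exact: open_over_cdom.
by apply: open_exists_chart => c [ac _]; exact: open_norm_coord_ne0.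
Qed.

Lemma measurable_cosphere_over : measurable (cosphere_over g H : set T).
Proof.
apply: measurableI; first exact: measurable_cosphere.
exact: measurable_over_hypersurface.
Qed.

(** Covectors whose dual vector is seen not to be tangent to [H] in some slice
    chart. Asking for some chart, instead of all of them, makes the set open and
    avoids comparing slice charts with one another. *)
Definition transversal_covectors : set (covector M) :=
  [set z | exists2 c, slice_chart H c & cdom c (base z) /\
    (coord z c *m invmx (gmx g c (bcoord z c))) 0 ord_max != 0].

Lemma open_transversal : open transversal_covectors.
Proof. by apply: open_exists_chart => c [ac _]; exact: open_velocity_ne0. Qed.

Lemma cosphere_of_transversal :
  cosphere_of g H = cosphere_over g H `&` ~` transversal_covectors.
Proof.
apply/seteqP; split => z [Sz Hz]; split => //.
  by move=> [c sc [cz /eqP]]; apply; exact: Hz.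
move=> c sc cz; apply/eqP; apply: contraT => vz.
by case: Hz; exists c.
Qed.

Lemma measurable_cosphere_of : measurable (cosphere_of g H : set T).
Proof.
rewrite cosphere_of_transversal; apply: measurableI.
  exact: measurable_cosphere_over.
apply: measurableC; apply: open_measurable_cotangent; exact: open_transversal.
Qed.

End BorelSets.

(** * Invariant measures near the hypersurface *)

Section InvariantMeasure.
Variables (R : realType) (n : nat) (M : smoothManifold R n.+1).
Variables (g : riemannianMetric M) (H : set M).
Hypothesis hypH : hypersurface H.
Variable phi : R -> covector M -> covector M.
Hypothesis phi_flow : is_flow g phi.
Local Notation T := (borel_cotangent M).
Variable mu : {finite_measure set T -> \bar R}.
Hypothesis mu_invariant : forall (t : R) (A : set T), measurable A ->
  mu (phi t @^-1` A) = mu A.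

Lemma flow_measurable t (A : set T) : measurable A ->
  measurable (phi t @^-1` A : set T).
Proof.
move=> mA; rewrite -[X in measurable X]setTI.
apply: (@measurability _ _ T T setT (phi t) (@open (covector M))) => //.
move=> _ [B oB <-]; rewrite setTI; apply: open_measurable_cotangent.
have : continuous (phi t).
  move=> z; have tz : (t, w) @[w --> z] --> (t, z).
    by refine (cvg_pair (G := nbhs t) (H := nbhs z) (cvg_cst t) cvg_id).
  refine (cvg_comp (fun w => (t, w)) (fun sw => phi sw.1 sw.2) tz _).
  have phi_cont := flow_continuous phi_flow.
  by refine (phi_cont (t, z)).
by move/continuousP; apply.
Qed.

(** Leaving [H] is a way of leaving a set of covectors over [H]. *)
Lemma escaping_null (A : set T) : measurable A ->
  (forall z, A z -> H (base z)) ->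
  (forall z, A z -> exists2 e : R, 0 < e &
     forall t, 0 < t < e -> ~ H (base (phi t z))) ->
  mu A = 0%E.
Proof.
move=> mA AH Aesc; apply: (@no_return_null _ T R mu phi) => //.
- exact: flowD phi_flow.
- exact: flow_measurable.
- move=> z /Aesc[e e0 eP]; exists e => // t te Ht.
  exact: eP t te (AH _ Ht).
Qed.

Lemma transversal_null :
  mu (cosphere_over g H `&` transversal_covectors g H) = 0%E.
Proof.
apply: escaping_null.
- apply: measurableI; first exact: measurable_cosphere_over.
  by apply: open_measurable_cotangent; exact: open_transversal.
- by move=> z [[]].
- move=> z [[_ Hz] [c sc [cz vz]]].
  have phi0 := flow0 phi_flow z.
  apply: (leaves_transversally (flow_integral phi_flow z) _ sc);
    by rewrite phi0.
Qed.

Lemma cosphere_of_momentum c z : fermi_chart g H c -> cosphere_of g H z ->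
  cdom c (base z) ->
  [/\ ccod c (bcoord z c), norm_coord (bcoord z c) = 0 &
      norm_coord (coord z c) = 0].
Proof.
move=> fc [[_ Hz] Tz] cz; have cx := bcoord_ccod cz; split => //.
  by have [[_ Hc] _] := fc; exact/(Hc _ cz).
rewrite -(fermi_velocity fc _ cx); apply: Tz => //.
by case: fc.
Qed.

Lemma support_II_null z : cosphere_of g H z ->
  msupport (restr mu (cosphere_of g H)) z -> II_null g H z.
Proof.
move=> Sz suppz c fc cz; have [[ac _] _] := fc.
have [cx x0 xi0] := cosphere_of_momentum fc Sz cz.
apply/eqP; apply: contraT => Q0z.
pose U := [set w : covector M | cdom c (base w) /\
  dp_base g c (bcoord w c) (coord w c) (delta_mx 0 ord_max) != 0].
have oU : open U by exact: open_dp_ne0.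
have Uz : U z by split => //; rewrite (fermi_Q0 fc)// mulf_neq0// pnatr_eq0.
suff U0 : mu (U `&` cosphere_of g H) = 0%E.
  by have := suppz U oU Uz; rewrite /restr U0 ltxx.
apply: escaping_null.
- apply: measurableI; first exact: open_measurable_cotangent.
  exact: measurable_cosphere_of.
- by move=> w [_ [[]]].
- move=> w [[cw dpw] Sw]; have phi0 := flow0 phi_flow w.
  have [_ _ xiw] := cosphere_of_momentum fc Sw cw.
  apply: (leaves_tangentially (flow_integral phi_flow w) _ fc); rewrite phi0//.
  by case: Sw => -[].
Qed.

End InvariantMeasure.

Theorem theorem1p4 (R : realType) (n : nat) (M : smoothManifold R n.+1)
  (M_compact : compact [set: M])
  (g : riemannianMetric M)
  (H : set M) (H_hypersurface : hypersurface H)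
  (phi : R -> covector M -> covector M) (phi_flow : is_flow g phi)
  (mu : probability (borel_cotangent M) R)
  (mu_cosphere : mu (cosphere g) = 1%E)
  (mu_invariant : forall (t : R) (A : set (borel_cotangent M)), measurable A ->
     mu (phi t @^-1` A) = mu A) :
  [/\ forall A : set (borel_cotangent M), measurable A ->
        restr mu (cosphere_over g H) A = restr mu (cosphere_of g H) A,
      cosphere_of g H `&` msupport (restr mu (cosphere_of g H))
        `<=` II_null g H &
      cosphere_of g H `&` msupport (restr mu (cosphere_of g H))
        `<=` fields_coincide g H].
Proof.
have nullQ z : cosphere_of g H z ->
    msupport (restr mu (cosphere_of g H)) z -> II_null g H z.
  exact: (support_II_null H_hypersurface phi_flow mu_invariant).
split.
- move=> A mA; rewrite /restr.
  have mO : measurable (transversal_covectors g H : set (borel_cotangent M)).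
    by apply: open_measurable_cotangent; exact: open_transversal.
  have mS := measurable_cosphere_over g H_hypersurface.
  have mF := measurable_cosphere_of g H_hypersurface.
  have null := transversal_null H_hypersurface phi_flow mu_invariant.
  have overE : A `&` cosphere_over g H = (A `&` cosphere_of g H) `|`
      (A `&` (cosphere_over g H `&` transversal_covectors g H)).
    rewrite cosphere_of_transversal -setIUr -setIUr.
    by rewrite setUC setUv setIT.
  have mAO : measurable (A `&` (cosphere_over g H `&` transversal_covectors g H)).
    by apply: measurableI => //; exact: measurableI.
  rewrite overE measureU0//; first exact: measurableI.
  apply: (subset_measure0 mAO _ _ null); first exact: measurableI.
  exact: subIsetr.
- by move=> z [Sz /(nullQ _ Sz)].
- move=> z [Sz suppz] c fc cz.
  have [cx x0 xi0] := cosphere_of_momentum fc Sz cz.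
  exact: (fermi_hamilton fc cx x0 xi0 (nullQ _ Sz suppz c fc cz)).
Qed.
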